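(* Let $\mathbb{K}$ be a field, $R=\mathbb{K}[x_1,\dots,x_d]$, and let $I$ be a (nonzero proper) monomial ideal of $R$. Let $e=\mathrm{lcm}\{v(I)\mid v\in\mathcal{RV}(I)\}$. Then the limits $\lim_{n\to\infty}\mathrm{sdepth}(R/I^{\frac{n}{e}})$ and $\lim_{n\to\infty}\mathrm{sdepth}(I^{\frac{n}{e}})$ exist. In particular, the limits $\lim_{n\to\infty}\mathrm{sdepth}(R/\overline{I^n})$ and $\lim_{n\to\infty}\mathrm{sdepth}(\overline{I^n})$ exist. Furthermore, $$\lim_{n\to\infty}\mathrm{sdepth}(R/I^{\frac{n}{e}})=\min_{n\geqslant 1}\mathrm{sdepth}(R/\overline{I^n})\quad\text{and}\quad \lim_{n\to\infty}\mathrm{sdepth}(I^{\frac{n}{e}})=\min_{n\geqslant 1}\mathrm{sdepth}(\overline{I^n}).$$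
   Context: Rational powers: for an ideal $I$ of a commutative ring $A$ and $\frac{a}{b}\in\mathbb{Q}_+$ with $a,b$ positive integers, $I^{\frac{a}{b}}=\{x\in A \mid x^b\in\overline{I^a}\}$, where $\overline{\phantom{I}}$ denotes integral closure of ideals; this is an ideal depending only on the rational number $\frac{a}{b}$, and it is monomial when $I$ is a monomial ideal of $R$. Rees valuations: for a nonzero proper ideal $I$ of $R$ and a discrete rank one valuation $v$ on the fraction field of $R$ that is nonnegative on $R$, put $v(I)=\min\{v(x)\mid 0\neq x\in I\}$. $\mathcal{RV}(I)$ denotes the set of Rees valuations of $I$, i.e. the unique (up to equivalence) minimal finite set of such valuations, normalized (value group $\mathbb{Z}$), for which, for all $n$: $x\in\overline{I^n}$ if and only if $v(x)\geqslant n\,v(I)$ for all $v\in\mathcal{RV}(I)$. Stanley depth: let $M$ be a finitely generated $\mathbb{Z}^d$-graded $R$-module. For homogeneous $u\in M$ and $Z\subseteq\{x_1,\dots,x_d\}$, if $u\cdot\mathbb{K}[Z]$ is a free $\mathbb{K}[Z]$-module it is called a Stanley space of dimension $|Z|$. A Stanley decomposition $\mathcal{D}$ of $M$ is a decomposition $M=u_1\mathbb{K}[Z_1]\oplus\dots\oplus u_r\mathbb{K}[Z_r]$, as $\mathbb{K}$-vector spaces, into finitely many Stanley spaces; $\mathrm{sdepth}(\mathcal{D})=\min_i|Z_i|$, and $\mathrm{sdepth}(M)$ is the maximum of $\mathrm{sdepth}(\mathcal{D})$ over all Stanley decompositions $\mathcal{D}$ of $M$. *)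

(* Defs.v *)
From mathcomp Require Import all_boot all_order all_algebra.
From mathcomp Require Import mpoly.
From mathcomp Require Import boolp classical_sets cardinality topology.

Set Implicit Arguments.
Unset Strict Implicit.
Unset Printing Implicit Defensive.

Import Order.TTheory GRing.Theory.
Local Open Scope classical_set_scope.
Local Open Scope ring_scope.

(* The least element of A, and the dummy value x0 if A has no least element. *)
Definition minimum disp (T : porderType disp) (x0 : T) (A : set T) : T :=
  xget x0 (A `&` lbound A).

Section Ideals.
Variable A : comNzRingType.
Implicit Types (I G : set A) (x : A) (n a b : nat).

Definition ideal_gen G : set A :=
  [set x | exists r (c g : 'I_r -> A),
             (forall i, G (g i)) /\ x = \sum_(i < r) c i * g i].

(* For n = 0 the empty product 1 is the only generator, so I^0 = A. *)
Definition ideal_pow I n : set A :=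
  ideal_gen [set y | exists2 g : 'I_n -> A,
                       forall i, I (g i) & y = \prod_(i < n) g i].

Definition integral_closure I : set A :=
  [set x | exists n (a : nat -> A),
    [/\ (0 < n)%N,
        forall i, (1 <= i <= n)%N -> ideal_pow I i (a i)
      & x ^+ n + \sum_(1 <= i < n.+1) a i * x ^+ (n - i) = 0]].

(* The rational power I^(a/b), meaningful for b > 0. *)
Definition rational_power I a b : set A :=
  [set x | integral_closure (ideal_pow I a) (x ^+ b)].

End Ideals.

Section ReesValuations.
Variable R : idomainType.
Local Notation F := {fraction R}.
Local Notation "x %:F" := (@tofrac R x).
Implicit Types (v : F -> int) (I : set R) (S RV : set (F -> int)).

(* Normalized discrete rank one valuations of F that are nonnegative on R.
   The value at 0, mathematically +oo, is pinned to the dummy value 0, so that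
   equivalent normalized valuations are equal as functions; it is never used. *)
Record normalized_valuation v : Prop := NormalizedValuation {
  val0 : v 0 = 0;
  valM : forall x y, x != 0 -> y != 0 -> v (x * y) = v x + v y;
  valD : forall x y, x != 0 -> y != 0 -> x + y != 0 ->
           Order.min (v x) (v y) <= v (x + y);
  val_surj : forall m : int, exists2 x, x != 0 & v x = m;
  val_ge0 : forall f : R, f != 0 -> 0 <= v f%:F
}.

Definition val_ideal v I : int :=
  minimum 0 [set m | exists x, [/\ I x, x != 0 & m = v x%:F]].

(* The case x = 0 holds by the convention v(0) = +oo, hence is left out. *)
Definition rees_property I S : Prop :=
  forall (n : nat) (x : R), x != 0 ->
    integral_closure (ideal_pow I n) x <->
    (forall v, S v -> val_ideal v I *+ n <= v x%:F).

Definition rees_valuations I RV : Prop :=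
  [/\ finite_set RV,
      forall v, RV v -> normalized_valuation v,
      rees_property I RV
    & forall S, S `<=` RV -> rees_property I S -> S = RV].

End ReesValuations.

Section StanleyDepth.
Variables (K : fieldType) (d : nat).
Local Notation R := {mpoly K[d]}.

Definition subpoly (Z : {set 'I_d}) : set R :=
  [set f | forall m, m \in msupp f -> forall i, m i != 0%N -> i \in Z].

(* A Z^d-graded module is presented as a subquotient U / V, for graded
   submodules V `<=` U of an R-module M whose homogeneous component of degree a
   is [gr a].  Elements of U / V are given by representatives in U. *)
Variables (M : lmodType R) (gr : ('I_d -> int) -> set M) (U V : set M).

Definition stanley_space (u : M) (Z : {set 'I_d}) : Prop :=
  [/\ U u, exists a, gr a u
    & forall f, subpoly Z f -> V (f *: u) -> f = 0].

Definition stanley_decomposition r (u : 'I_r -> M) (Z : 'I_r -> {set 'I_d})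
    : Prop :=
  [/\ forall i, stanley_space (u i) (Z i),
      forall w, U w -> exists2 f : 'I_r -> R,
        forall i, subpoly (Z i) (f i) & V (w - \sum_(i < r) f i *: u i)
    & forall f : 'I_r -> R, (forall i, subpoly (Z i) (f i)) ->
        V (\sum_(i < r) f i *: u i) -> forall i, V (f i *: u i)].

(* All the cardinals are at most d, so for r > 0 this is their minimum. *)
Definition sdepth_decomposition r (Z : 'I_r -> {set 'I_d}) : nat :=
  \big[minn/d]_(i < r) #|Z i|.

Definition sdepth : nat :=
  \max_(k < d.+1 | `[< exists r (u : 'I_r -> M) (Z : 'I_r -> {set 'I_d}),
      stanley_decomposition u Z /\ sdepth_decomposition Z = k >]) k.

End StanleyDepth.

Section MonomialIdeals.
Variables (K : fieldType) (d : nat).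
Local Notation R := {mpoly K[d]}.
Implicit Types J : set R.

Definition monomial_ideal J : Prop :=
  exists S : set 'X_{1..d}, J = ideal_gen [set 'X_[K, m] | m in S].

Definition poly_grading (a : 'I_d -> int) : set R^o :=
  [set f : R | forall m, m \in msupp f -> forall i, (m i)%:Z = a i].

Definition sdepth_ideal J : nat :=
  sdepth poly_grading (J : set R^o) [set 0].

Definition sdepth_quotient J : nat :=
  sdepth poly_grading setT (J : set R^o).

End MonomialIdeals.

(* Main.v *)
Require Import Defs.
From mathcomp Require Import all_boot all_order all_algebra.
From mathcomp Require Import mpoly.
From mathcomp Require Import boolp classical_sets cardinality fsbigop topology.
From mathcomp Require Import zify.

Set Implicit Arguments.
Unset Strict Implicit.
Unset Printing Implicit Defensive.

Import Order.TTheory GRing.Theory Num.Theory.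
Local Open Scope classical_set_scope.
Local Open Scope ring_scope.

(** Every Rees valuation v of I has v(I) > 0, by minimality of the set of Rees
    valuations, so e is a positive multiple of each v(I).  A monomial x^m lies
    in I^(n/e) exactly when n <= (e / v(I)) v(x^m) for all v, an inequality
    between integers whose right side is additive in m.  Hence
    x^m is in I^(n/e) if and only if x^(k m) is in I^(j/e), whenever
    k (n - 1) < j <= k n: a multiple of k is at least j as soon as it exceeds
    k (n - 1) ([rational_exponents_scale]).

    A Stanley decomposition of a quotient of monomial ideals is a partition of
    a set of exponents into translated coordinate cones
    ([stanley_cone_partition], [cone_partition_stanley]).  The preimage of such
    a cone under m |-> k m is empty or again a cone in the same directions, so
    decompositions for I^(j/e) pull back to decompositions for I^(n/e) with no
    smaller depth ([sdepth_monomial_le]).  Thus sdepth at j is at most sdepth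
    at n.  For fixed n every large j lies in some interval (k (n - 1), k n], so
    the sequence is eventually bounded by each of its terms, that is,
    eventually equal to its minimum ([eventually_minimum]).  The closures of the
    powers of I form the subsequence of indices n e, which reaches the same
    value.

    This requires the rational powers of I to be spanned by monomials
    ([rational_power_monomial]), although the Rees valuations are not known to
    be monomial valuations.  A Rees valuation v is replaced by the order with
    weights m |-> v(x^m), which agrees with v on monomials; an equation of
    integral dependence over a power of I then bounds from below the weight of
    every monomial of its root ([weight_ge_integral]), and these bounds, over
    all v, are the membership criterion for that monomial. *)

(** * The filtration of a polynomial ring by weights *)

Section Weights.
Variables (R : idomainType) (n : nat) (w : 'X_{1..n} -> int).
Hypothesis wD : {morph w : m1 m2 / (m1 + m2)%MM >-> m1 + m2}.
Implicit Types (c : int) (f g : {mpoly R[n]}).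

Definition weight_ge c : set {mpoly R[n]} :=
  [set f | forall m, m \in msupp f -> c <= w m].

Lemma weight0 : w 0%MM = 0.
Proof. by apply: (addrI (w 0%MM)); rewrite -wD addm0 addr0. Qed.

Lemma weight_ge0 c : weight_ge c 0.
Proof. by move=> m; rewrite msupp0. Qed.

Lemma weight_ge1 : weight_ge 0 1.
Proof. by move=> m; rewrite msupp1 inE => /eqP->; rewrite weight0. Qed.

Lemma weight_ge_le c c' f : c' <= c -> weight_ge c f -> weight_ge c' f.
Proof. by move=> le fc m /fc; apply: le_trans. Qed.

Lemma weight_geD c f g : weight_ge c f -> weight_ge c g -> weight_ge c (f + g).
Proof.
by move=> fc gc m /msuppD_le; rewrite mem_cat => /orP[/fc|/gc].
Qed.

Lemma weight_geN c f : weight_ge c f -> weight_ge c (- f).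
Proof. by move=> fc m; rewrite (perm_mem (msuppN f)) => /fc. Qed.

Lemma weight_ge_sum c (T : eqType) (r : seq T) (P : pred T)
    (F : T -> {mpoly R[n]}) :
  (forall i, i \in r -> P i -> weight_ge c (F i)) ->
  weight_ge c (\sum_(i <- r | P i) F i).
Proof.
move=> Fc; rewrite big_seq_cond; apply: (big_ind (weight_ge c)).
- exact: weight_ge0.
- by move=> f g; apply: weight_geD.
- by move=> i /andP[]; apply: Fc.
Qed.

Lemma weight_geM c1 c2 f g :
  weight_ge c1 f -> weight_ge c2 g -> weight_ge (c1 + c2) (f * g).
Proof.
by move=> fc gc m /msuppM_le /allpairsP[[m1 m2]] /= [/fc ? /gc ? ->]; rewrite wD lerD.
Qed.

Lemma weight_geX c k f : weight_ge c f -> weight_ge (c *+ k) (f ^+ k).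
Proof.
move=> fc; elim: k => [|k IHk]; first exact: weight_ge1.
by rewrite exprS mulrS; apply: weight_geM.
Qed.

End Weights.

Section WeightedOrder.
Variables (R : idomainType) (n : nat) (w : 'X_{1..n} -> int).
Hypothesis wD : {morph w : m1 m2 / (m1 + m2)%MM >-> m1 + m2}.
Implicit Types (c : int) (f g : {mpoly R[n]}) (J : set {mpoly R[n]}).

(** The associated graded ring of the weight filtration is the polynomial ring
    itself, hence reduced: if the c-homogeneous part g of f were nonzero, g^k
    would be a nonzero part of f^k of weight exactly c k. *)
Lemma weight_ge_root c k f :
  weight_ge w c f -> weight_ge w (c *+ k + 1) (f ^+ k) -> weight_ge w (c + 1) f.
Proof.
move=> fc fk.
pose g := \sum_(m <- msupp f | w m == c) f@_m *: 'X_[m].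
pose h := \sum_(m <- msupp f | w m != c) f@_m *: 'X_[m].
have fE : f = g + h by rewrite [LHS]mpolyE (bigID (fun m => w m == c)).
have hc : weight_ge w (c + 1) h.
  apply: weight_ge_sum => m /fc mc wm m' /msuppZ_le; rewrite msuppX inE => /eqP->.
  by move: mc wm; lia.
have gc : weight_ge w c g.
  apply: weight_ge_sum => m _ /eqP wm m' /msuppZ_le; rewrite msuppX inE => /eqP->.
  by rewrite wm.
(* Bounds for the opposite weight are upper bounds for w. *)
pose w' m := - w m.
have w'D : {morph w' : m1 m2 / (m1 + m2)%MM >-> m1 + m2}.
  by move=> m1 m2; rewrite /w' wD opprD.
have g'c : weight_ge w' (- c) g.
  apply: weight_ge_sum => m _ /eqP wm m' /msuppZ_le; rewrite msuppX inE => /eqP->.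
  by rewrite /w' wm.
have fgk j : weight_ge w (c *+ j + 1) (f ^+ j - g ^+ j).
  elim: j => [|j IHj]; first by rewrite subrr; apply: weight_ge0.
  have -> : f ^+ j.+1 - g ^+ j.+1 = f * (f ^+ j - g ^+ j) + h * g ^+ j.
    rewrite !exprS mulrBr -addrA; congr (_ + _).
    by rewrite [X in - (X * _) + _]fE mulrDl opprD addrNK.
  apply: weight_geD.
    by rewrite mulrS -addrA; apply: weight_geM.
  by rewrite mulrS addrAC; apply: weight_geM => //; apply: weight_geX.
have gk0 : g ^+ k = 0.
  apply: contrapT => /eqP; rewrite -msupp_eq0.
  case E: (msupp _) => [//|m s] _.
  have mg : m \in msupp (g ^+ k) by rewrite E mem_head.
  have : weight_ge w (c *+ k + 1) (g ^+ k).
    rewrite -[g ^+ k](subKr (f ^+ k)); apply: weight_geD => //.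
    exact: weight_geN.
  move=> /(_ m mg); have := weight_geX w'D g'c mg.
  by rewrite /w' mulNrn; lia.
move/eqP: gk0; rewrite expf_eq0 => /andP[_ /eqP g0].
by rewrite fE g0 add0r.
Qed.

Lemma weight_ge_ideal_gen c J :
  (forall m, 0 <= w m) -> J `<=` weight_ge w c -> ideal_gen J `<=` weight_ge w c.
Proof.
move=> w_ge0 Jc _ [r [a [g [Jg ->]]]]; apply: weight_ge_sum => i _ _.
by rewrite -[c]add0r; apply: weight_geM => //; apply: Jc.
Qed.

(** Nonnegative weights make each step of the filtration an ideal, and the
    filtration is multiplicative. *)
Lemma weight_ge_ideal_pow c k J :
  (forall m, 0 <= w m) ->
  J `<=` weight_ge w c -> ideal_pow J k `<=` weight_ge w (c *+ k).
Proof.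
move=> w_ge0 Jc; apply: weight_ge_ideal_gen => // _ [g Jg ->].
elim: k g Jg => [|k IHk] g Jg; first by rewrite big_ord0; apply: weight_ge1.
by rewrite big_ord_recl mulrS; apply: weight_geM => //; [apply: Jc|apply: IHk].
Qed.

(** If f has order at least mu with mu k < c, then all terms a_i f^(k (N - i))
    of the integral equation of f^k have order greater than mu k N, hence so
    has f^(k N), and f has order at least mu + 1.  Starting from order 0, the
    order of f rises until it reaches c / k. *)
Lemma weight_ge_integral c k J f :
    (0 < k)%N -> (forall m, 0 <= w m) -> J `<=` weight_ge w c ->
    integral_closure J (f ^+ k) ->
  forall m, m \in msupp f -> c <= w m *+ k.
Proof.
move=> k_gt0 w_ge0 Jc [N [a [N_gt0 Ja fN]]] m mf.
have step (mu : int) :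
    mu *+ k < c -> weight_ge w mu f -> weight_ge w (mu + 1) f.
  move=> mu_c fmu; apply: (@weight_ge_root mu (k * N)) => //.
  rewrite exprM.
  move/eqP: fN; rewrite addr_eq0 => /eqP->; apply: weight_geN.
  apply: weight_ge_sum => i; rewrite mem_index_iota => /andP[i_gt0 iN] _.
  have : weight_ge w (c *+ i + mu *+ (k * (N - i))) (a i * f ^+ (k * (N - i))).
    apply: weight_geM => //; last exact: weight_geX.
    by apply: (@weight_ge_ideal_pow c i J) => //; apply: Ja; rewrite i_gt0.
  rewrite -exprM; apply: weight_ge_le.
  have -> : (k * N = k * i + k * (N - i))%N by rewrite -mulnDr subnKC.
  rewrite mulrnDr addrAC lerD2r mulrnA.
  have : mu *+ k + 1 <= c by lia.
  move=> /(ler_wMn2r i); rewrite mulrnDl => h.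
  rewrite (le_trans _ h) // lerD2l.
  by move: i_gt0; case: (i) => // j _; rewrite mulrS lerDl mulrn_wge0.
(* The last order reached is the first j with c <= j k, that is,
   j k < c + k. *)
have lt_weight (j : nat) : j%:Z *+ k < c + k%:Z -> weight_ge w j f.
  elim: j => [_|j IHj jc]; first by move=> m' _; apply: w_ge0.
  have jc' : j%:Z *+ k < c by move: jc; rewrite intS mulrnDl natz addrC ltrD2r.
  rewrite -addn1 PoszD; apply: step => //; apply: IHj.
  by rewrite (lt_le_trans jc') // lerDl.
rewrite leNgt; apply/negP => wm_c.
have /lt_weight /(_ _ mf) : (`|w m|%N.+1)%:Z *+ k < c + k%:Z.
  by rewrite intS mulrnDl natz addrC ltrD2r gez0_abs.
by have := w_ge0 m; lia.
Qed.

End WeightedOrder.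

(** * Stanley decompositions as partitions into cones *)

Section StanleyCones.
Variables (K : fieldType) (d : nat).
Local Notation R := {mpoly K[d]}.
Implicit Types (b m : 'X_{1..d}) (Z : {set 'I_d}) (f w : R) (A B C : set 'X_{1..d}).

Definition in_cone b Z m : bool :=
  [forall i, (b i <= m i)%N && ((i \in Z) || (m i == b i))].

Definition cone_partition C r (b : 'I_r -> 'X_{1..d}) (Z : 'I_r -> {set 'I_d}) :=
  (forall m, C m <-> exists i, in_cone (b i) (Z i) m) /\
  (forall i j m, in_cone (b i) (Z i) m -> in_cone (b j) (Z j) m -> i = j).

Definition monomial_span A : set R :=
  [set f | forall m, m \in msupp f -> A m].

Definition up_closed A := forall m m', A m -> A (m + m')%MM.

Lemma in_coneP b Z m :
  reflect (exists2 z : 'X_{1..d}, (forall i, z i != 0%N -> i \in Z) & m = (b + z)%MM)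
          (in_cone b Z m).
Proof.
apply: (iffP forallP) => [mb|[z zZ ->] i].
  exists (m - b)%MM => [i|].
    by rewrite mnmBE; have /andP[_ /orP[//|/eqP->]] := mb i; rewrite subnn.
  by apply/mnmP => i; rewrite mnmDE mnmBE subnKC //; have /andP[] := mb i.
rewrite mnmDE leq_addr /=.
by have [/zZ->//|/negbNE/eqP->] := boolP (z i != 0%N); rewrite addn0 eqxx orbT.
Qed.

Lemma cone_base b Z : in_cone b Z b.
Proof. by apply/forallP => i; rewrite leqnn eqxx orbT. Qed.

Lemma subpolyX Z c m : (forall i, m i != 0%N -> i \in Z) -> subpoly Z (c *: 'X_[K, m]).
Proof. by move=> mZ p /msuppZ_le; rewrite msuppX inE => /eqP->. Qed.

Lemma msupp_cone Z f c b m :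
  subpoly Z f -> m \in msupp (f * (c *: 'X_[b])) -> in_cone b Z m.
Proof.
move=> fZ /msuppM_le /allpairsP[[z b']] /= [/fZ zZ /msuppZ_le].
rewrite msuppX inE => /eqP -> ->.
by apply/in_coneP; exists z => //; rewrite addmC.
Qed.

Lemma homogeneous_monomial a (u : R) :
  poly_grading a u -> u != 0 -> exists2 c, c != 0 & exists b, u = c *: 'X_[b].
Proof.
move=> ua; rewrite -msupp_eq0; case E: (msupp u) => [//|b s] _.
have bu : b \in msupp u by rewrite E mem_head.
exists u@_b; first by rewrite -mcoeff_msupp.
exists b; apply/mpolyP => m; rewrite mcoeffZ mcoeffX.
have [<-|bm] := eqVneq b m; first by rewrite mulr1.
rewrite mulr0; apply/eqP; rewrite mcoeff_eq0; apply: contra bm => mu.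
apply/eqP/mnmP => i; apply/eqP; rewrite -eqz_nat.
by rewrite (ua b bu) (ua m mu).
Qed.

Lemma mcoeff_filter (P : pred 'X_{1..d}) w m :
  (\sum_(p <- msupp w | P p) w@_p *: 'X_[p])@_m = if P m then w@_m else 0.
Proof.
transitivity (\sum_(p <- msupp w) (if P m then (w@_p *: 'X_[p])@_m else 0)).
  rewrite raddf_sum big_mkcond; apply: eq_bigr => p _ /=.
  by rewrite mcoeffZ mcoeffX; case: eqVneq => [->//|_]; rewrite mulr0 !if_same.
by case: ifP => _; [rewrite -raddf_sum -mpolyE|rewrite big1].
Qed.

(** Homogeneous elements are terms c x^b, and b supplies the vertex of the cone.
    Freeness of the Stanley spaces keeps the cones off B, the spanning
    condition applied to monomials makes them cover, and the directness of the
    sum applied to two terms with opposite values makes them disjoint. *)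
Lemma stanley_cone_partition A B r (u : 'I_r -> R^o)
    (Z : 'I_r -> {set 'I_d}) :
    up_closed A ->
    stanley_decomposition (@poly_grading K d) (monomial_span A : set R^o)
      (monomial_span B : set R^o) u Z ->
  exists b : 'I_r -> 'X_{1..d}, cone_partition (A `\` B) b Z.
Proof.
move=> upA [uZ cover indep].
have uX i : exists cb : K * 'X_{1..d}, cb.1 != 0 /\ u i = cb.1 *: 'X_[cb.2].
  have [_ [a ua] free] := uZ i.
  have u_neq0 : u i != 0.
    apply/eqP => u0; have /eqP : (1 : R) = 0.
      apply: free => [m|]; first by rewrite msupp1 inE => /eqP-> j; rewrite mnm0E.
      by rewrite u0 => m; rewrite scaler0 msupp0.
    by rewrite oner_eq0.
  have [c c_neq0 [b uE]] := homogeneous_monomial ua u_neq0.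
  by exists (c, b).
have [cb cbP] := choice uX.
pose c i := (cb i).1; pose b i := (cb i).2.
have c_neq0 i : c i != 0 by case: (cbP i).
have uE i : u i = c i *: 'X_[b i] by case: (cbP i).
(* Each monomial of a cone is reached with coefficient 1 from its space. *)
have cone_elt i (z : 'X_{1..d}) : (forall j, z j != 0%N -> j \in Z i) ->
    ((c i)^-1 *: 'X_[z] : R) *: u i = 'X_[b i + z] :> R.
  move=> zZ; rewrite uE -[LHS]/(_ * _) -scalerAl -scalerAr scalerA mulVf //.
  by rewrite scale1r -mpolyXD addmC.
have coneC i m : in_cone (b i) (Z i) m -> (A `\` B) m.
  move=> /in_coneP[z zZ ->]; have [Au _ free] := uZ i; split.
    apply: upA; apply: Au; rewrite uE.
    by rewrite (perm_mem (msuppZ _ (c_neq0 i))) msuppX inE.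
  move=> Bm; have /eqP : ((c i)^-1 *: 'X_[z] : R) = 0.
    apply: free; first exact: subpolyX.
    by rewrite cone_elt // => p; rewrite msuppX inE => /eqP->.
  by rewrite -msupp_eq0 msuppMCX // invr_neq0.
exists b; split=> [m|i j m].
  split=> [[Am Bm]|[i]]; last exact: coneC.
  have Xm : monomial_span A ('X_[m] : R).
    by move=> p; rewrite msuppX inE => /eqP->.
  have [f fZ Bf] := cover _ Xm.
  apply: contrapT => nex.
  apply/Bm/Bf; rewrite mcoeff_msupp mcoeffB mcoeffX eqxx raddf_sum big1 ?subr0 ?oner_eq0 //.
  move=> i _; apply/eqP; rewrite mcoeff_eq0; apply/negP => mi.
  by apply: nex; exists i; move: mi; rewrite uE; apply: msupp_cone.
move=> mi mj; have [_ Bm] := coneC _ _ mi.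
apply: contrapT => /eqP ij; apply: Bm.
have /in_coneP[zi ziZ mE] := mi; have /in_coneP[zj zjZ mE'] := mj.
pose f l : R := if l == i then (c i)^-1 *: 'X_[zi]
                else if l == j then - ((c j)^-1 *: 'X_[zj]) else 0.
have fi : f i *: u i = 'X_[m] by rewrite /f eqxx cone_elt // -mE.
have : monomial_span B (f i *: u i).
  apply: indep => [l|].
    rewrite /f; case: eqVneq => [->|_]; first exact: subpolyX.
    case: eqVneq => [->|_]; last by move=> p; rewrite msupp0.
    by rewrite -scaleNr; apply: subpolyX.
  rewrite (bigD1 i) //= (bigD1 j) /=; last by rewrite eq_sym.
  rewrite big1 => [|l /andP[li lj]].
    rewrite fi /f (negPf (_ : j != i)) 1?eq_sym // eqxx scaleNr cone_elt // -mE'.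
    by rewrite addr0 subrr => p; rewrite msupp0.
  by rewrite /f (negPf li) (negPf lj) scale0r.
by rewrite fi; apply; rewrite msuppX inE.
Qed.

(** The component of w in the space of a cone is the sum of the terms of w whose
    exponent lies in that cone; terms with exponent in B lie in no cone. *)
Lemma cone_partition_stanley A B r (b : 'I_r -> 'X_{1..d})
    (Z : 'I_r -> {set 'I_d}) :
    cone_partition (A `\` B) b Z ->
  stanley_decomposition (@poly_grading K d) (monomial_span A : set R^o)
    (monomial_span B : set R^o) (fun i => 'X_[b i] : R^o) Z.
Proof.
move=> [cover disj].
have coneC i m : in_cone (b i) (Z i) m -> (A `\` B) m by move=> ?; apply/cover; exists i.
have msupp_coneX i f m :
    subpoly (Z i) f -> m \in msupp (f * 'X_[b i]) -> in_cone (b i) (Z i) m.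
  by rewrite -[X in _ * X]scale1r; apply: msupp_cone.
split=> [i|w Aw|f fZ Bf i].
- split.
  + by move=> m; rewrite msuppX inE => /eqP->; have [] := coneC i _ (cone_base _ _).
  + by exists (fun j => (b i j)%:Z) => m; rewrite msuppX inE => /eqP->.
  + move=> f fZ Bf; have : f * 'X_[b i] = 0.
      apply/eqP; rewrite -msupp_eq0; case E: (msupp _) => [//|m s].
      have mf : m \in msupp (f * 'X_[b i]) by rewrite E mem_head.
      by have [_] := coneC i m (msupp_coneX _ _ _ fZ mf); case; apply: Bf.
    move/eqP; rewrite mulf_eq0 => /orP[/eqP//|].
    by rewrite -msupp_eq0 msuppX.
- pose f i : R := \sum_(m <- msupp w | in_cone (b i) (Z i) m) w@_m *: 'X_[m - b i].
  have fE i m : (f i * 'X_[b i])@_m = if in_cone (b i) (Z i) m then w@_m else 0.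
    rewrite -mcoeff_filter mulr_suml; congr (_@__); apply: eq_bigr => p mp.
    rewrite -scalerAl -mpolyXD submK //; apply/mnm_lepP => j.
    by have /forallP/(_ j)/andP[] := mp.
  exists f => [i m|m].
    move=> /msupp_sum_le /flatten_mapP[p]; rewrite mem_filter => /andP[mp _].
    move=> /msuppZ_le; rewrite msuppX inE => /eqP-> j.
    by rewrite mnmBE; have /forallP/(_ j)/andP[_ /orP[//|/eqP->]] := mp; rewrite subnn.
  apply: contraPP => Bm; apply/negP; rewrite -mcoeff_eq0 mcoeffB raddf_sum subr_eq0 /=.
  have [mi|nex] := pselect (exists i, in_cone (b i) (Z i) m).
    have [i mi'] := mi; rewrite (bigD1 i) //= big1 => [|j ji].
      by rewrite addr0 fE mi'.
    rewrite fE; case: ifP => // mj; case/eqP: ji.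
    exact: disj mj mi'.
  rewrite big1 => [|i _]; last first.
    by rewrite fE; case: ifP => // mi; case: nex; exists i.
  rewrite mcoeff_eq0; apply/negP => /Aw Am; apply: nex.
  by apply/cover.
- have -> : f i *: ('X_[b i] : R^o) = 0; last by move=> m; rewrite msupp0.
  apply/eqP; rewrite -msupp_eq0; case E: (msupp _) => [//|m s].
  have mf : m \in msupp (f i * 'X_[b i]) by rewrite E mem_head.
  have mi := msupp_coneX _ _ _ (fZ i) mf.
  have [_] := coneC i m mi; case; apply: Bf.
  rewrite mcoeff_msupp raddf_sum (bigD1 i) //= big1 => [|j ji].
    by rewrite addr0 -mcoeff_msupp.
  apply/eqP; rewrite mcoeff_eq0; apply: contra ji => mj; apply/eqP.
  exact: disj (msupp_coneX _ _ _ (fZ j) mj) mi.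
Qed.

End StanleyCones.

(** * Pulling back decompositions along a dilation *)

Section Contraction.
Variables (K : fieldType) (d : nat).
Local Notation R := {mpoly K[d]}.
Implicit Types (b m : 'X_{1..d}) (Z : {set 'I_d}) (A B C : set 'X_{1..d}).

(** Along the directions of Z the condition is b_j <= k m_j, solved by rounding
    b_j / k up; along the others it is b_j = k m_j, which has a solution only
    if k divides b_j. *)
Lemma in_cone_scale k b Z m : (0 < k)%N ->
  in_cone b Z (m *+ k) =
  [forall (j | j \notin Z), (k %| b j)%N]
    && in_cone [multinom (b j + k.-1) %/ k | j < d]%N Z m.
Proof.
move=> k_gt0.
have ceil_le x y : ((x + k.-1) %/ k <= y)%N = (x <= y * k)%N.
  rewrite -ltnS ltn_divLR // mulSn; case: k k_gt0 => // k _ /=.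
  by rewrite addSn ltnS addnC leq_add2l.
apply/forallP/andP => [bm|[/forall_inP kb /forallP bm] j].
  split; first apply/forall_inP => j jZ.
    by have := bm j; rewrite (negPf jZ) mulmnE => /andP[_ /eqP<-]; apply: dvdn_mull.
  apply/forallP => j; rewrite mnmE ceil_le.
  have := bm j; rewrite mulmnE => /andP[-> /orP[->//|/eqP<-]] /=.
  by rewrite divnMDl // divn_small ?addn0 ?eqxx ?orbT // prednK.
have := bm j; rewrite mnmE ceil_le mulmnE => /andP[-> /orP[->//|/eqP->]] /=.
have [//|/kb/dvdnP[q ->]] := boolP (j \in Z).
by rewrite divnMDl // divn_small ?addn0 ?eqxx // prednK.
Qed.

(** Some cones of the given partition have an empty preimage; h enumerates the
    others, and their directions are unchanged. *)
Lemma cone_partition_contract k C C' r (b : 'I_r -> 'X_{1..d})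
    (Z : 'I_r -> {set 'I_d}) :
    (0 < k)%N -> (forall m, C m <-> C' (m *+ k)%MM) -> cone_partition C' b Z ->
  exists s (h : 'I_s -> 'I_r) (b' : 'I_s -> 'X_{1..d}),
    cone_partition C b' (Z \o h).
Proof.
move=> k_gt0 CC' [cover disj].
pose good (i : 'I_r) := [forall (j | j \notin Z i), (k %| b i j)%N].
pose h (i : 'I_#|good|) : 'I_r := enum_val i.
have h_good i : good (h i) by apply: (enum_valP i).
exists #|good|, h, (fun i => [multinom (b (h i) j + k.-1) %/ k | j < d]%N).
have coneE i m : in_cone [multinom (b (h i) j + k.-1) %/ k | j < d]%N ((Z \o h) i) m
    = in_cone (b (h i)) (Z (h i)) (m *+ k).
  by rewrite in_cone_scale //; have := h_good i; rewrite /good => ->.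
split=> [m|i j m].
  split=> [/CC'/cover[i mi]|[i]].
    have gi : i \in good by move: (mi); rewrite in_cone_scale // => /andP[].
    by exists (enum_rank_in gi i); rewrite coneE /h enum_rankK_in.
  by rewrite coneE => mi; apply/CC'/cover; exists (h i).
by rewrite !coneE => mi mj; apply: enum_val_inj; apply: disj mi mj.
Qed.

Lemma sdepth_decomposition_le r s (Z : 'I_r -> {set 'I_d}) (h : 'I_s -> 'I_r) :
  (sdepth_decomposition Z <= sdepth_decomposition (Z \o h))%N.
Proof.
rewrite /sdepth_decomposition -minEnat -leEnat.
apply/bigmin_geP; split=> [|i _]; first exact: bigmin_le_id.
exact: bigmin_le_cond.
Qed.

(** Discarding the cones with empty preimage can only raise the least dimension,
    also when no cone remains, since the minimum over no cones is d. *)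
Lemma sdepth_monomial_le k A B A' B' :
    (0 < k)%N -> up_closed A' ->
    (forall m, A m <-> A' (m *+ k)%MM) -> (forall m, B m <-> B' (m *+ k)%MM) ->
  (sdepth (@poly_grading K d) (monomial_span A' : set R^o) (monomial_span B' : set R^o)
   <= sdepth (@poly_grading K d) (monomial_span A : set R^o)
        (monomial_span B : set R^o))%N.
Proof.
move=> k_gt0 upA' AA' BB'.
apply/bigmax_leqP => t /asboolP[r [u [Z [dec <-]]]].
have [b bP] := stanley_cone_partition upA' dec.
have CC' m : (A `\` B) m <-> (A' `\` B') (m *+ k)%MM.
  by split=> -[Am Bm]; split=> [|]; first [exact/AA'|move/BB'].
have [s [h [b' /(@cone_partition_stanley K) dec']]] := cone_partition_contract k_gt0 CC' bP.
apply: leq_trans (sdepth_decomposition_le Z h) _.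
have le_d : (sdepth_decomposition (Z \o h) < d.+1)%N.
  by rewrite ltnS /sdepth_decomposition -minEnat -leEnat; apply: bigmin_le_id.
apply: (leq_bigmax_cond (Ordinal le_d)); apply/asboolP.
by exists s, (fun i => 'X_[b' i]), (Z \o h).
Qed.

End Contraction.

(** * Rees valuations and rational powers *)

Section Valuations.
Variable R : idomainType.
Implicit Types (v : {fraction R} -> int) (J : set R) (RV : set ({fraction R} -> int)).
Local Notation "x %:F" := (@tofrac R x).

Lemma valuationX v x k : normalized_valuation v -> x != 0 -> v (x ^+ k) = v x *+ k.
Proof.
move=> vv x_neq0; elim: k => [|k IHk].
  apply: (addrI (v 1)).
  by rewrite -(Defs.valM vv) ?oner_neq0 // mulr1 addr0.
by rewrite exprS mulrS (Defs.valM vv) ?expf_neq0 // IHk.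
Qed.

Lemma val_ideal_ge0 v J : normalized_valuation v -> 0 <= val_ideal v J.
Proof.
move=> vv; rewrite /val_ideal /minimum.
by case: xgetP => // m _ [[x [_ x_neq0 ->]] _]; apply: val_ge0.
Qed.

(** Nonnegativity of v on the ring makes the set of values well ordered, so the
    minimum is attained and not the dummy value. *)
Lemma val_ideal_le v J x :
  normalized_valuation v -> J x -> x != 0 -> val_ideal v J <= v x%:F.
Proof.
move=> vv Jx x_neq0; rewrite /val_ideal /minimum.
set A := [set m | _].
have A_ge0 m : A m -> 0 <= m by case=> y [_ y_neq0 ->]; apply: val_ge0.
have Ax : A (v x%:F) by exists x.
have exA : exists j : nat, `[< A j%:Z >].
  by exists `|v x%:F|%N; apply/asboolP; rewrite gez0_abs // A_ge0.
have [_ lbA] : (A `&` lbound A) (xget 0 (A `&` lbound A)).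
  apply: xgetPex; case: (ex_minnP exA) => j /asboolP Aj j_min.
  exists j%:Z; split=> // m Am; have m_ge0 := A_ge0 m Am.
  by rewrite -(gez0_abs m_ge0) lez_nat j_min //; apply/asboolP; rewrite gez0_abs.
exact: lbA.
Qed.

Section ReesProperty.
Variables (J : set R) (RV : set ({fraction R} -> int)).
Hypothesis J_RV : rees_valuations J RV.

(** A valuation with v(J) = 0 imposes no condition, so minimality excludes it.
    This is what makes the least common multiple of the v(J) positive. *)
Lemma rees_valuation_gt0 v : RV v -> 0 < val_ideal v J.
Proof.
have [_ RVval RVrees RVmin] := J_RV.
suff <- : RV `&` [set u | 0 < val_ideal u J] = RV by case.
apply: RVmin => [u []//|n x x_neq0]; rewrite RVrees //.
split=> [xn u [RVu _]|xn u RVu]; first exact: xn.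
have := val_ideal_ge0 J (RVval u RVu); rewrite le_eqVlt => /predU1P[<-|u_gt0].
  by rewrite mul0rn; apply: val_ge0 => //; apply: RVval.
by apply: xn.
Qed.

Lemma rational_powerP a b x : x != 0 ->
  rational_power J a b x <->
  (forall v, RV v -> val_ideal v J *+ a <= v x%:F *+ b).
Proof.
have [_ RVval RVrees _] := J_RV.
move=> x_neq0; rewrite /rational_power /= RVrees ?expf_neq0 //.
split=> xab v RVv; have := xab v RVv; rewrite tofracXn valuationX ?tofrac_eq0 //;
  exact: RVval.
Qed.

End ReesProperty.

Lemma rational_power_0 J a b : (0 < b)%N -> rational_power J a b 0.
Proof.
move=> b_gt0; exists 1%N, (fun=> 0); split=> // [i _|].
  by exists 0%N, (fun=> 0), (fun=> 0); split=> [[]//|]; rewrite big_ord0.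
by rewrite big_nat1 mul0r addr0 expr1 expr0n -[b == _]negbK -lt0n b_gt0.
Qed.

Lemma val_sum_ge v (t : int) b (T : eqType) (r : seq T) (F : T -> R) :
    normalized_valuation v ->
    (forall i, i \in r -> F i != 0 -> t <= v (F i)%:F *+ b) ->
  \sum_(i <- r) F i != 0 -> t <= v (\sum_(i <- r) F i)%:F *+ b.
Proof.
move=> vv Ft; rewrite big_seq.
apply: (big_ind (fun x : R => x != 0 -> t <= v x%:F *+ b)) => // [|x y xt yt].
  by rewrite eqxx.
have [->|x_neq0] := eqVneq x 0; first by rewrite add0r.
have [->|y_neq0] := eqVneq y 0; first by rewrite addr0.
move=> xy_neq0.
have : Order.min (v x%:F) (v y%:F) <= v (x + y)%:F.
  by rewrite tofracD; apply: (Defs.valD vv); rewrite -?tofracD tofrac_eq0.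
move=> /(ler_wMn2r b); apply: le_trans.
by rewrite minEle; case: ifP => _; [apply: xt|apply: yt].
Qed.

End Valuations.

(** * Rational powers of monomial ideals *)

Section MonomialIdealPowers.
Variables (K : fieldType) (d : nat).
Local Notation R := {mpoly K[d]}.
Variables (I : set R) (RV : set ({fraction R} -> int)).
Hypotheses (I_monomial : monomial_ideal I) (I_RV : rees_valuations I RV).
Local Notation "x %:F" := (@tofrac R x).

Definition rational_exponents a b : set 'X_{1..d} :=
  [set m | forall v, RV v -> val_ideal v I *+ a <= v ('X_[m])%:F *+ b].

Lemma mpolyX_neq0 (m : 'X_{1..d}) : 'X_[m] != 0 :> R.
Proof. by rewrite -msupp_eq0 msuppX. Qed.

Lemma monomial_valD v : normalized_valuation v ->
  {morph (fun m : 'X_{1..d} => v ('X_[m])%:F) : m1 m2 / (m1 + m2)%MM >-> m1 + m2}.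
Proof.
by move=> vv m1 m2; rewrite mpolyXD tofracM (Defs.valM vv) // tofrac_eq0 mpolyX_neq0.
Qed.

Lemma monomial_val_ge0 v (m : 'X_{1..d}) : normalized_valuation v -> 0 <= v ('X_[m])%:F.
Proof. by move=> vv; apply: val_ge0 => //; apply: mpolyX_neq0. Qed.

Lemma monomial_ideal_weight v : normalized_valuation v ->
  I `<=` weight_ge (fun m => v ('X_[m])%:F) (val_ideal v I).
Proof.
move=> vv; have [S IE] := I_monomial.
rewrite {1}IE; apply: weight_ge_ideal_gen; first exact: monomial_valD.
  by move=> m; apply: monomial_val_ge0.
move=> _ [m Sm <-] m'; rewrite msuppX inE => /eqP->.
apply: val_ideal_le => //; last exact: mpolyX_neq0.
rewrite IE; exists 1%N, (fun=> 1), (fun=> 'X_[m]).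
by rewrite big_ord1 mul1r; split=> // _; exists m.
Qed.

(** That the monomials of f belong to the power comes from the weights
    m |-> v(x^m); the converse is the ultrametric inequality for v. *)
Lemma rational_power_monomial a b : (0 < b)%N ->
  rational_power I a b = monomial_span (rational_exponents a b).
Proof.
have [_ RVval _ _] := I_RV.
move=> b_gt0; apply/seteqP; split=> f.
  move=> fab m mf v RVv; have vv := RVval v RVv.
  apply: (weight_ge_integral (monomial_valD vv) b_gt0 _ _ fab mf).
    by move=> m'; apply: monomial_val_ge0.
  apply: weight_ge_ideal_pow; first exact: monomial_valD.
    by move=> m'; apply: monomial_val_ge0.
  exact: monomial_ideal_weight.
have [->|f_neq0] := eqVneq f 0; first by move=> _; apply: rational_power_0.
move=> fm; apply/(rational_powerP I_RV) => // v RVv; have vv := RVval v RVv.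
move: f_neq0; rewrite [f]mpolyE; apply: val_sum_ge => // m mf _.
have c_neq0 : f@_m != 0 by rewrite -mcoeff_msupp.
have cMP_neq0 : (f@_m)%:MP_[d] != 0 by rewrite mpolyC_eq0.
rewrite -mul_mpolyC tofracM (Defs.valM vv) ?tofrac_eq0 ?mpolyX_neq0 // mulrnDl.
rewrite (le_trans (fm m mf v RVv)) // lerDr mulrn_wge0 //.
exact: val_ge0.
Qed.

Lemma rational_exponents_up a b : up_closed (rational_exponents a b).
Proof.
have [_ RVval _ _] := I_RV.
move=> m m' mab v RVv; rewrite (monomial_valD (RVval v RVv)) mulrnDl.
by rewrite (le_trans (mab v RVv)) // lerDl mulrn_wge0 // monomial_val_ge0 //; apply: RVval.
Qed.

Lemma rational_power_mul n b : (0 < b)%N ->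
  rational_power I (n * b) b = integral_closure (ideal_pow I n).
Proof.
move=> b_gt0.
have -> : integral_closure (ideal_pow I n) = rational_power I n 1.
  by apply/seteqP; split=> f; rewrite /rational_power /= expr1.
rewrite !rational_power_monomial //; congr monomial_span.
apply/seteqP; split=> m mn v RVv; have := mn v RVv; rewrite mulrnA ler_pMn2r //.
Qed.

(** With e = c v(I), the two conditions at v read n <= c v(x^m) and
    j <= k c v(x^m); they are equivalent because k c v(x^m) is a multiple
    of k. *)
Lemma rational_exponents_scale e n k j m :
    (forall v, RV v -> (`|val_ideal v I|%N %| e)%N) ->
    (0 < n)%N -> (k * n.-1 < j <= k * n)%N ->
  rational_exponents n e m <-> rational_exponents j e (m *+ k)%MM.
Proof.
have [_ RVval _ _] := I_RV.
move=> RVe n_gt0 /andP[j_gt j_le].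
suff scale v : RV v -> (val_ideal v I *+ n <= v ('X_[m])%:F *+ e)
                 = (val_ideal v I *+ j <= v ('X_[m *+ k])%:F *+ e).
  by split=> mn v RVv; have := mn v RVv; rewrite scale.
move=> RVv; have vv := RVval v RVv.
rewrite -mpolyXn tofracXn valuationX ?tofrac_eq0 ?mpolyX_neq0 //.
have vI_gt0 := rees_valuation_gt0 I_RV RVv.
have [c ->] := dvdnP (RVe v RVv).
have := monomial_val_ge0 m vv.
case: (val_ideal v I) vI_gt0 => [q|//] q_gt0; case: (v _) => [x|//] _.
rewrite -!mulrnA -[_ *+ n]mulr_natr -[_ *+ j]mulr_natr -[x%:Z *+ _]mulr_natr -[x%:Z *+ _]mulr_natr.
rewrite !natz -!PoszM !lez_nat.
rewrite [(c * _)%N]mulnC [(k * _)%N]mulnCA !(mulnCA x) !leq_pmul2l //.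
apply/idP/idP => h; nia.
Qed.

End MonomialIdealPowers.

(** * Sequences eventually equal to their minimum *)

(** Take k = ceil(j / n): then 0 <= k n - j < n <= k, the last step because
    j >= n^2. *)
Lemma scale_interval n j :
  (0 < n)%N -> (n ^ 2 <= j)%N -> exists2 k, (0 < k)%N & (k * n.-1 < j <= k * n)%N.
Proof.
move=> n_gt0 nj.
exists ((j + n.-1) %/ n)%N; first by rewrite divn_gt0 //; nia.
have := divn_eq (j + n.-1) n; have := ltn_pmod (j + n.-1) n_gt0.
set k := ((j + n.-1) %/ n)%N; move=> r_lt jE.
have : (n <= k)%N by rewrite leq_divRL //; nia.
nia.
Qed.

(** Past n0^2, where n0 is an index of the least term, every term is at most
    s n0 and hence equal to it. *)
Lemma eventually_minimum (s : nat -> nat) :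
    (forall n k j, (0 < n)%N -> (0 < k)%N -> (k * n.-1 < j <= k * n)%N -> (s j <= s n)%N) ->
  exists2 n0, (0 < n0)%N /\ (forall n, (0 < n)%N -> s n0 <= s n)%N
            & forall n, (n0 ^ 2 <= n)%N -> s n = s n0.
Proof.
move=> s_le.
have exs : exists y, `[< exists2 n, (0 < n)%N & s n = y >].
  by exists (s 1%N); apply/asboolP; exists 1%N.
case: (ex_minnP exs) => y /asboolP[n0 n0_gt0 <-] y_min.
have n0_min n : (0 < n)%N -> (s n0 <= s n)%N.
  by move=> n_gt0; apply: y_min; apply/asboolP; exists n.
exists n0 => // n n_ge; apply/eqP; rewrite eqn_leq; apply/andP; split.
  by have [k k_gt0 /s_le->] := scale_interval n0_gt0 n_ge.
by apply: n0_min; apply: leq_trans n_ge; rewrite expn_gt0 n0_gt0.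
Qed.

Lemma lim_minimum (s t : nat -> nat) e : (0 < e)%N ->
    (forall n, t n = s (n * e)%N) ->
    (forall n k j, (0 < n)%N -> (0 < k)%N -> (k * n.-1 < j <= k * n)%N -> (s j <= s n)%N) ->
  [/\ cvg (s n @[n --> \oo]), cvg (t n @[n --> \oo])
    & lim (s n @[n --> \oo]) =
      minimum 0%N [set t n | n in [set n : nat | (1 <= n)%N]]].
Proof.
move=> e_gt0 tE /eventually_minimum[n0 [n0_gt0 n0_min] s_const].
have s_near : \forall n \near \oo, s n = s n0.
  by exists (n0 ^ 2)%N => // n /= /s_const.
have t_near : \forall n \near \oo, t n = s n0.
  exists (n0 ^ 2)%N => // n /= n_ge.
  by rewrite tE; apply: s_const; rewrite (leq_trans n_ge) ?leq_pmulr.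
split; [exact: (is_cvg_near_cst (s n0))|exact: (is_cvg_near_cst (s n0))|].
rewrite (@lim_near_cst _ discrete_hausdorff _ _ _ (s n0)) //.
rewrite /minimum; set A := [set _ | _ in _].
have A_lb : lbound A (s n0).
  by move=> _ [n /= n_gt0 <-]; rewrite tE leEnat; apply: n0_min; rewrite muln_gt0 n_gt0.
have A_s : A (s n0).
  exists (n0 ^ 2)%N; first by rewrite /= expn_gt0 n0_gt0.
  by rewrite tE; apply: s_const; apply: leq_pmulr.
have [A_x x_lb] : (A `&` lbound A) (xget 0%N (A `&` lbound A)).
  by apply: xgetPex; exists (s n0).
by apply/eqP; rewrite eq_le A_lb // x_lb.
Qed.

(** * The limits of the Stanley depths *)

Lemma fsbig_lcmn_gt0 (A : set nat) :
  finite_set A -> (forall m, A m -> (0 < m)%N) -> (0 < \big[lcmn/1%N]_(m \in A) m)%N.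
Proof.
move=> finA A_gt0; rewrite fsbig_finite //= big_seq.
apply: (big_ind (fun m => 0 < m)%N) => // [x y|m].
  by rewrite lcmn_gt0 => ->.
by rewrite in_fset_set // inE => /A_gt0.
Qed.

Lemma dvdn_fsbig_lcmn (A : set nat) m :
  finite_set A -> A m -> (m %| \big[lcmn/1%N]_(k \in A) k)%N.
Proof. by move=> finA Am; rewrite (fsbigD1 m) //= dvdn_lcml. Qed.

Theorem theorem3 (K : fieldType) (d : nat) (I : set {mpoly K[d]})
    (RV : set ({fraction {mpoly K[d]}} -> int))
    (I_monomial : monomial_ideal I)
    (I_nonzero : I <> [set 0])
    (I_proper : I <> setT)
    (I_RV : rees_valuations I RV) :
  let e : nat :=
    \big[lcmn/1%N]_(m \in [set `|val_ideal v I|%N | v in RV]) m in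
  [/\ cvg (sdepth_quotient (rational_power I n e) @[n --> \oo]),
      cvg (sdepth_ideal (rational_power I n e) @[n --> \oo]),
      cvg (sdepth_quotient (integral_closure (ideal_pow I n)) @[n --> \oo])
    & cvg (sdepth_ideal (integral_closure (ideal_pow I n)) @[n --> \oo])] /\
  (lim (sdepth_quotient (rational_power I n e) @[n --> \oo]) =
     minimum 0%N [set sdepth_quotient (integral_closure (ideal_pow I n))
                 | n in [set n : nat | (1 <= n)%N]]) /\
  (lim (sdepth_ideal (rational_power I n e) @[n --> \oo]) =
     minimum 0%N [set sdepth_ideal (integral_closure (ideal_pow I n))
                 | n in [set n : nat | (1 <= n)%N]]).
Proof.
move=> e; have [finRV _ _ _] := I_RV.
have fin_vals := finite_image (fun v => `|val_ideal v I|%N) finRV.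
have e_gt0 : (0 < e)%N.
  apply: fsbig_lcmn_gt0 => // _ [v RVv <-].
  by rewrite absz_gt0 gt_eqF // (rees_valuation_gt0 I_RV).
have RVe v : RV v -> (`|val_ideal v I|%N %| e)%N.
  by move=> RVv; apply: dvdn_fsbig_lcmn => //; exists v.
(* An opaque e keeps conversion from computing the least common multiple. *)
clearbody e.
have scale n k j m := @rational_exponents_scale _ _ _ _ I_RV e n k j m RVe.
have up n : up_closed (rational_exponents I RV n e) by apply: rational_exponents_up.
have span n := rational_power_monomial I_monomial I_RV n e_gt0.
have T_span : [set: {mpoly K[d]}] = monomial_span [set: 'X_{1..d}].
  by apply/seteqP; split.
have O_span : [set 0] = monomial_span (K := K) (set0 : set 'X_{1..d}).
  apply/seteqP; split=> [_ -> m|f f0]; first by rewrite msupp0.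
  apply/eqP; rewrite -msupp_eq0; case E: (msupp f) => [//|m s].
  by case: (f0 m); rewrite E mem_head.
have closureE n : integral_closure (ideal_pow I n) = rational_power I (n * e) e.
  by rewrite (rational_power_mul I_monomial I_RV).
have q_le n k j : (0 < n)%N -> (0 < k)%N -> (k * n.-1 < j <= k * n)%N ->
    (sdepth_quotient (rational_power I j e) <= sdepth_quotient (rational_power I n e))%N.
  move=> n_gt0 k_gt0 nkj; rewrite /sdepth_quotient !span T_span.
  apply: (@sdepth_monomial_le K d k setT (rational_exponents I RV n e) setT) => // m.
  exact: scale.
have i_le n k j : (0 < n)%N -> (0 < k)%N -> (k * n.-1 < j <= k * n)%N ->
    (sdepth_ideal (rational_power I j e) <= sdepth_ideal (rational_power I n e))%N.
  move=> n_gt0 k_gt0 nkj; rewrite /sdepth_ideal !span O_span.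
  apply: (@sdepth_monomial_le K d k (rational_exponents I RV n e) set0 _ set0) => // m.
  exact: scale.
have [cvgq cvgq' limq] :=
  lim_minimum e_gt0 (fun n => congr1 (@sdepth_quotient K d) (closureE n)) q_le.
have [cvgi cvgi' limi] :=
  lim_minimum e_gt0 (fun n => congr1 (@sdepth_ideal K d) (closureE n)) i_le.
exact: (conj (And4 cvgq cvgi cvgq' cvgi') (conj limq limi)).
Qed.
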